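(* Let $\Sigma$ be a finite nonempty alphabet and let $S = \{x_1, \ldots, x_k\} \subseteq \Sigma^*$ be a finite set with $n = \max_{1 \le i \le k} |x_i| \ge 1$. Then $$\mathrm{sc}(S^* ) \le \frac{2}{2|\Sigma| - 1}\left(2^n |\Sigma|^n - 1\right).$$
   Context: For a regular language $L$ over $\Sigma$, $\mathrm{sc}(L)$ is the number of states of the minimal (complete) DFA over $\Sigma$ accepting $L$. *)

(* Defs.v *)
From mathcomp Require Import all_boot all_order all_algebra.
From mathcomp Require Import finmap boolp classical_sets.
Set Implicit Arguments.
Unset Strict Implicit.
Unset Printing Implicit Defensive.
Local Open Scope classical_set_scope.

Definition language (Sigma : finType) := set (seq Sigma).

(* Completeness of the automaton is the totality of dfa_trans. *)
Record dfa (Sigma : finType) := DFA {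
  dfa_state : finType;
  dfa_start : dfa_state;
  dfa_final : pred dfa_state;
  dfa_trans : dfa_state -> Sigma -> dfa_state }.

Definition dfa_lang (Sigma : finType) (A : dfa Sigma) : language Sigma :=
  [set w | dfa_final (foldl (@dfa_trans Sigma A) (dfa_start A) w)].

Definition regular (Sigma : finType) (L : language Sigma) : Prop :=
  exists A : dfa Sigma, dfa_lang A = L.

Definition has_dfa_of_size (Sigma : finType) (L : language Sigma) (m : nat) :=
  exists A : dfa Sigma, dfa_lang A = L /\ #|dfa_state A| = m.

Lemma regular_has_dfa (Sigma : finType) (L : language Sigma) :
  regular L -> exists m, `[< has_dfa_of_size L m >].
Proof.
by case=> A AL; exists #|dfa_state A|; apply/asboolP; exists A.
Qed.

(* The value is independent of the regularity proof: ex_minn returns the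
   least m satisfying the predicate. *)
Definition sc (Sigma : finType) (L : language Sigma) (hL : regular L) : nat :=
  ex_minn (regular_has_dfa hL).

Definition kstar (Sigma : finType) (L : language Sigma) : language Sigma :=
  [set w | exists ws : seq (seq Sigma),
             (forall x, x \in ws -> L x) /\ w = flatten ws].

(* Main.v *)
Require Import Defs.
From mathcomp Require Import all_boot all_order all_algebra.
From mathcomp Require Import finmap boolp classical_sets.
From mathcomp Require Import zify ring.
Set Implicit Arguments.
Unset Strict Implicit.
Unset Printing Implicit Defensive.
Local Open Scope ring_scope.

(** Write n = m + 1.  A DFA for S^* only has to remember the last
    i = min(|w|, m) letters of the word w read so far, together with i + 1
    bits telling which of the prefixes of w obtained by erasing 0, ..., i
    letters belong to S^*: the word w a is in S^* exactly when some suffix of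
    w a of length between 1 and m + 1 is in S and the complementary prefix is
    in S^*.  There are at most sum_(i <= m) |Sigma|^i 2^(i+1) such memories,
    and this geometric sum is the bound. *)

(** The kernel of [f] is a right congruence that saturates [L], so [f w] can serve as the state
    reached on [w], each transition being computed on an arbitrary representative word. *)
Lemma has_dfa_of_invariant (Sigma T : finType) (L : language Sigma)
    (f : seq Sigma -> T) :
  (forall v w, f v = f w -> L v -> L w) ->
  (forall v w a, f v = f w -> f (rcons v a) = f (rcons w a)) ->
  has_dfa_of_size L #|T|.
Proof.
move=> fL fS.
(* Values outside the range of [f] get the default word [[::]]; they are unreachable states, so the
   choice is harmless. *)
pose rep t := xget [::] [set w | f w = t]%classic.
have repK w : f (rep (f w)) = f w by apply: (xgetPex [::] (P := [set v | f v = f w]%classic)); exists w.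
pose A := {| dfa_state := T; dfa_start := f [::];
  dfa_final := fun t => `[< L (rep t) >];
  dfa_trans := fun t a => f (rcons (rep t) a) |}.
exists A; split => //.
have run w : foldl (@dfa_trans _ A) (dfa_start A) w = f w.
  elim/last_ind: w => //= w a IH.
  by rewrite -cats1 foldl_cat /= IH cats1; apply/fS/repK.
apply/seteqP; split=> w; rewrite /dfa_lang /= run.
  by move/asboolP; apply/fL/repK.
by move=> Lw; apply/asboolP; apply: fL Lw; rewrite repK.
Qed.

Lemma sc_le_size (Sigma : finType) (L : language Sigma) (hL : regular L) m :
  has_dfa_of_size L m -> (sc hL <= m)%N.
Proof.
by move=> hm; rewrite /sc; case: ex_minnP => k _; apply; apply/asboolP.
Qed.

(** The last nonempty factor of a factorization ends with [a]; [k] counts its other letters. *)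
Lemma kstar_rconsP (Sigma : finType) (L : language Sigma) w a :
  kstar L (rcons w a) <->
  exists k, [/\ (k <= size w)%N, kstar L (take (size w - k) w)
              & L (rcons (drop (size w - k) w) a)].
Proof.
split=> [[ws []]|[k [kw [ws [Lws wsE]] Lx]]]; last first.
  exists (rcons ws (rcons (drop (size w - k) w) a)); split.
    by move=> x; rewrite mem_rcons inE => /orP[/eqP->|/Lws].
  by rewrite flatten_rcons -wsE -rcons_cat cat_take_drop.
elim/last_ind: ws => [_ /(congr1 size)|ws x IH Lws].
  by rewrite size_rcons.
have Lws' y : y \in ws -> L y.
  by move=> yws; apply: Lws; rewrite mem_rcons inE yws orbT.
(* An empty last factor is discarded by induction. *)
rewrite flatten_rcons; case/lastP: x Lws => [|y b] Lws.
  by rewrite cats0; apply: IH.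
rewrite -rcons_cat => /rcons_inj[wE ab]; exists (size y).
rewrite wE size_cat addnK take_size_cat // drop_size_cat // leq_addl; split=> //.
  by exists ws.
by rewrite ab; apply: Lws; rewrite mem_rcons mem_head.
Qed.

Section Memory.
Variables (Sigma : finType) (L : language Sigma) (m : nat).

Definition window (w : seq Sigma) := drop (size w - m) w.

Definition star_bits (w : seq Sigma) :=
  mkseq (fun j => `[< kstar L (take (size w - j) w) >]) (size (window w)).+1.

Definition memory : finType :=
  {i : 'I_m.+1 & (i.-tuple Sigma * i.+1.-tuple bool)%type}.

Definition memory_seqs (t : memory) : seq Sigma * seq bool :=
  (val (tagged t).1, val (tagged t).2).

Lemma size_window w : size (window w) = minn (size w) m.
Proof. by rewrite size_drop; lia. Qed.

Lemma size_window_lt w : (size (window w) < m.+1)%N.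
Proof. by rewrite size_window ltnS geq_minr. Qed.

Lemma size_star_bits w : size (star_bits w) == (size (window w)).+1.
Proof. by rewrite size_mkseq. Qed.

Definition memory_of (w : seq Sigma) : memory :=
  existT (fun i : 'I_m.+1 => (i.-tuple Sigma * i.+1.-tuple bool)%type)
    (Ordinal (size_window_lt w))
    (in_tuple (window w), Tuple (size_star_bits w)).

(** The length of the window determines the index [i], so memories can be compared as plain
    sequences. *)
Lemma memory_seqs_inj : injective memory_seqs.
Proof.
move=> [i [u b]] [j [v c]] [/= uv bc].
have ij : i = j by apply: val_inj; rewrite /= -(size_tuple u) uv size_tuple.
by case: _ / ij v c uv bc => v c /val_inj-> /val_inj->.
Qed.

Lemma memory_ofP v w :
  memory_of v = memory_of w <->
  window v = window w /\ star_bits v = star_bits w.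
Proof.
split=> [vw|[uE bE]].
  split; first exact: (congr1 (fun t => (memory_seqs t).1) vw).
  exact: (congr1 (fun t => (memory_seqs t).2) vw).
by apply: memory_seqs_inj; rewrite /memory_seqs /= uE bE.
Qed.

Lemma card_memory :
  #|memory| = (\sum_(i < m.+1) #|Sigma| ^ i * 2 ^ i.+1)%N.
Proof.
rewrite card_tagged sumnE big_map big_enum /=.
by apply: eq_bigr => i _; rewrite card_prod !card_tuple card_bool.
Qed.

Lemma window_rcons w a :
  window (rcons w a) =
  drop (size (rcons (window w) a) - m) (rcons (window w) a).
Proof.
rewrite /window size_rcons -!cats1 size_cat size_drop /=.
case: (leqP (size w) m) => wm.
  have -> : (size w - m = 0)%N by lia.
  by rewrite drop0; congr drop; lia.
(* The window is already full here: appending [a] pushes out exactly its first letter. *)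
have -> : (size w - (size w - m) + 1 - m = 1)%N by lia.
have -> : drop (size w - m) w ++ [:: a] = drop (size w - m) (w ++ [:: a]).
  rewrite drop_cat; case: ltnP => // wm'; rewrite drop_oversize //.
  by have -> : (size w - m - size w = 0)%N by lia.
by rewrite drop_drop; congr drop; lia.
Qed.

Lemma nth_star_bits w j : (j <= size (window w))%N ->
  nth false (star_bits w) j = `[< kstar L (take (size w - j) w) >].
Proof. by move=> jw; rewrite nth_mkseq. Qed.

(** Erasing j + 1 letters from [rcons w a] is erasing j letters from [w]: the old bits shift by one,
    and the truncation discards the oldest one once the window is full. *)
Lemma star_bits_rcons w a :
  star_bits (rcons w a) =
  take (size (window (rcons w a))).+1
    (`[< kstar L (rcons w a) >] :: star_bits w).
Proof.
have sE := size_window (rcons w a); have sE' := size_window w.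
rewrite size_rcons in sE.
apply: (@eq_from_nth _ false) => [|j].
  have := eqP (size_star_bits w); move: (star_bits w) => b bE.
  by rewrite size_mkseq size_take /= bE; case: ltnP; lia.
rewrite size_mkseq => jlt; rewrite nth_take // nth_star_bits //.
case: j jlt => [|j] jlt; first by rewrite subn0 take_size.
rewrite /= nth_star_bits; last lia.
rewrite size_rcons subSS -cats1 takel_cat //; lia.
Qed.

Hypothesis sizeL : forall x, L x -> (size x <= m.+1)%N.

(** By [sizeL], the last factor consists of [a] and at most [m] letters before it, all of which lie
    in the window. *)
Lemma kstar_rcons_memory w a :
  kstar L (rcons w a) <->
  exists k, [/\ (k <= size (window w))%N, nth false (star_bits w) k
     & L (rcons (drop (size (window w) - k) (window w)) a)].
Proof.
have dropE k : (k <= size (window w))%N ->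
    drop (size (window w) - k) (window w) = drop (size w - k) w.
  rewrite size_window /window drop_drop => kw; congr drop; lia.
rewrite kstar_rconsP; split=> -[k [kw kL kx]]; exists k.
  have kw' : (k <= size (window w))%N.
    by have := sizeL kx; rewrite size_rcons size_drop size_window; lia.
  by rewrite dropE // nth_star_bits //; split=> //; apply/asboolP.
rewrite -dropE //; split=> //; first by move: kw; rewrite size_window; lia.
by move: kL; rewrite nth_star_bits // => /asboolP.
Qed.

Lemma kstar_has_dfa : has_dfa_of_size (kstar L) #|memory|.
Proof.
apply: (@has_dfa_of_invariant _ _ _ memory_of).
  (* Bit 0 erases nothing, so it decides acceptance. *)
  move=> v w /memory_ofP[_ /(congr1 (nth false ^~ 0%N))].
  rewrite !nth_star_bits // !subn0 !take_size => vw.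
  by move/asboolP; rewrite vw => /asboolP.
move=> v w a /memory_ofP[uE bE]; apply/memory_ofP.
have uaE : window (rcons v a) = window (rcons w a) by rewrite !window_rcons uE.
split=> //; rewrite !star_bits_rcons uaE bE.
suff -> : kstar L (rcons v a) = kstar L (rcons w a) by [].
by apply/propext; rewrite !kstar_rcons_memory uE bE.
Qed.

End Memory.

(** Up to a factor 2 this is the geometric sum of ratio 2s, and 2s differs from 1. *)
Lemma geometric_bound (F : numFieldType) (s n : nat) : (0 < s)%N ->
  (\sum_(i < n) s ^ i * 2 ^ i.+1)%N%:R =
  2 / (2 * s%:R - 1) * (2 ^+ n * s%:R ^+ n - 1) :> F.
Proof.
move=> s0; have d0 : 2 * s%:R - 1 != 0 :> F.
  by rewrite GRing.subr_eq0 -GRing.natrM Num.Theory.pnatr_eq1; lia.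
rewrite -GRing.exprMn GRing.subrX1 GRing.mulrA GRing.divfK //.
rewrite GRing.natr_sum GRing.mulr_sumr; apply: eq_bigr => i _.
by rewrite GRing.natrM !GRing.natrX GRing.exprMn GRing.exprS; ring.
Qed.

Theorem theorem12 (Sigma : finType) (S : {fset (seq Sigma)}) (n : nat)
    (hSigma : (0 < #|Sigma|)%N)
    (hn : n = (\max_(x <- S) size x)%N)
    (hn1 : (1 <= n)%N) :
  exists hL : regular (kstar [set` S]%classic),
    (sc hL)%:R <=
      2 / (2 * #|Sigma|%:R - 1) * (2 ^+ n * #|Sigma|%:R ^+ n - 1) :> rat.
Proof.
case: n hn hn1 => // m hn _.
have sizeS x : [set` S]%classic x -> (size x <= m.+1)%N.
  by move=> xS; rewrite hn; apply: (@leq_bigmax_seq _ (enum_fset S) xpredT size).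
have hA := kstar_has_dfa sizeS.
have hL : regular (kstar [set` S]%classic) by case: hA => A [AL _]; exists A.
exists hL; rewrite -geometric_bound // Num.Theory.ler_nat -card_memory.
exact: sc_le_size.
Qed.
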